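(* The emptiness problem for probabilistic finite state transducers computing a relation with probability $2/3$ is undecidable: there is no algorithm which, given (a finite description of) a pfst $T$ that computes some relation $\mathcal R$ with probability $2/3$, decides whether $\mathcal R=\emptyset$. Likewise, the emptiness problem for quantum finite state transducers computing a relation with probability $2/3$ is undecidable.
   Context: A probabilistic finite state transducer (pfst) is a tuple $T=(Q,\Sigma_1,\Sigma_2,V,f,q_0,Q_{\rm acc},Q_{\rm rej})$ with finite state set $Q$, finite input/output alphabets $\Sigma_1,\Sigma_2$, initial state $q_0$, disjoint accepting/rejecting sets $Q_{\rm acc},Q_{\rm rej}\subseteq Q$ (the other states are non-halting). For each $a\in\Sigma_1\cup\{\ddagger,\$\}$ ($\ddagger,\$$ are end markers) there is a stochastic $Q\times Q$ matrix $V_a$ and an output function $f_a:Q\to\Sigma_2^*$; $V_\$$ puts all probability on halting states. On input $v$ the machine reads $\ddagger v\$$; in state $q$ reading $a$ it appends $f_a(q)$ to the output tape and moves to state $p$ with probability $(V_a)_{qp}$; if $p$ is accepting (rejecting) it halts and accepts with the current output (rejects). $T(w|v)$ is the probability of accepting with output $w$ on input $v$. A quantum finite state transducer (qfst) has the same data except that each $V_a$ is a unitary on $\ell^2(Q)$ (and $V_\$$ maps the span of non-halting states into the span of halting states). Its non-halting part is a vector $\psi=\sum_{q,w}\alpha_{qw}|q\rangle\otimes|w\rangle\in\ell^2(Q\times\Sigma_2^* )$, initially $|q_0\rangle\otimes|\epsilon\rangle$; reading $a$ maps it to $\psi'=\sum_{q,w}\alpha_{qw}V_a|q\rangle\otimes|wf_a(q)\rangle$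 with $V_a|q\rangle=\sum_p(V_a)_{qp}|p\rangle$, after which the squared norm of the component of $\psi'$ on $\mathrm{span}(Q_{\rm acc})\otimes|x\rangle$ is added to the probability of accepting with output $x$, the squared norm of the component on $\mathrm{span}(Q_{\rm rej})\otimes\ell^2(\Sigma_2^* )$ to the rejection probability, and the computation continues with the projection onto non-halting states. $T(w|v)$ is defined analogously. For $\alpha>1/2$, $T$ computes $\mathcal R\subseteq\Sigma_1^*\times\Sigma_2^*$ with probability $\alpha$ if for all $v,w$: $(v,w)\in\mathcal R\Rightarrow T(w|v)\ge\alpha$ and $(v,w)\notin\mathcal R\Rightarrow T(w|v)\le1-\alpha$. *)

(* Defs.v *)
From HB Require Import structures.
From mathcomp Require Import all_boot all_order all_algebra all_field.
Set Implicit Arguments. Unset Strict Implicit. Unset Printing Implicit Defensive.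
Import Order.TTheory GRing.Theory Num.Theory.
Local Open Scope ring_scope.

(* Model of computation: counter (Minsky) machines, which are Turing   *)
(* complete.  Registers are indexed by nat; the input is placed in     *)
(* register 0, the output is read from register 0 upon halting.       *)
Inductive cm_instr :=
| CInc of nat
| CDec of nat & nat.

Definition cm_state := (nat * (nat -> nat))%type.

Definition cm_step (P : seq cm_instr) (s : cm_state) : cm_state :=
  let: (pc, reg) := s in
  if (pc < size P)%N then
    match nth (CInc 0) P pc with
    | CInc r => (pc.+1, fun j => if j == r then (reg j).+1 else reg j)
    | CDec r k => if reg r == 0%N then (k, reg)
                  else (pc.+1, fun j => if j == r then (reg j).-1 else reg j)
    end
  else s.

Definition cm_init (x : nat) : cm_state := (0%N, fun j => if j == 0%N then x else 0%N).

Definition cm_halts_with (P : seq cm_instr) (x y : nat) : Prop :=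
  exists n : nat, let s := iter n (cm_step P) (cm_init x) in
    (size P <= s.1)%N /\ s.2 0%N = y.

(* Finite descriptions of transducers.                                 *)
(* States are 0 .. nst-1, input letters 0 .. nin-1, output letters     *)
(* 0 .. nout-1.  The input end markers are coded as: start marker      *)
(* (double dagger) = nin, end marker ($) = nin.+1.  V is the list of   *)
(* the nin+2 transition matrices (row q, column p = (V_a)_{qp}) and    *)
(* f the list of the nin+2 output functions (f a q = f_a(q)).          *)
Record fst_desc (K : Type) := FstDesc {
  fd_nst : nat; fd_nin : nat; fd_nout : nat; fd_q0 : nat;
  fd_acc : seq nat; fd_rej : seq nat;
  fd_V : seq (seq (seq K)); fd_f : seq (seq (seq nat)) }.

Definition pfst := fst_desc rat.
Definition qfst := fst_desc algC.

Section FstDefs.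
Variable K : nzRingType.
Variable T : fst_desc K.

Definition fd_start := fd_nin T.
Definition fd_end := (fd_nin T).+1.
Definition fd_entry (a q p : nat) : K := nth 0 (nth [::] (nth [::] (fd_V T) a) q) p.
Definition fd_out (a q : nat) : seq nat := nth [::] (nth [::] (fd_f T) a) q.
Definition fd_mx (a : nat) : 'M[K]_(fd_nst T) := \matrix_(i, j) fd_entry a i j.
Definition fd_halting (q : nat) : bool := (q \in fd_acc T) || (q \in fd_rej T).

Definition fd_shape_ok : Prop :=
  [/\ (fd_q0 T < fd_nst T)%N,
      all (fun q => q < fd_nst T)%N (fd_acc T) && all (fun q => q < fd_nst T)%N (fd_rej T),
      (forall q, ~~ ((q \in fd_acc T) && (q \in fd_rej T))),
      (size (fd_V T) = (fd_nin T).+2 /\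
       all (fun M => (size M == fd_nst T) && all (fun r => size r == fd_nst T) M) (fd_V T))
    & (size (fd_f T) = (fd_nin T).+2 /\
       all (fun F => (size F == fd_nst T) && all (all (fun b => b < fd_nout T)%N) F) (fd_f T))].

(* (Unnormalised) weight after reading the reversed prefix r : the     *)
(* weight of being moved to state p with output u, having not halted   *)
(* before the last step: a probability for a pfst, an amplitude for a *)
(* qfst (in both cases weights propagate linearly; the projection onto *)
(* non-halting states is applied after every step but the initial one).*)
Fixpoint fd_weight (r : seq nat) (p : nat) (u : seq nat) : K :=
  match r with
  | [::] => if (p == fd_q0 T) && (u == [::]) then 1 else 0
  | a :: r' =>
      \sum_(q <- iota 0 (fd_nst T))
        (if suffix (fd_out a q) u && ~~ ((r' != [::]) && fd_halting q)
         then fd_weight r' q (take (size u - size (fd_out a q)) u) * fd_entry a q p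
         else 0)
  end.

Definition fd_tape (v : seq nat) : seq nat := fd_start :: v ++ [:: fd_end].

End FstDefs.

Definition pfst_wf (T : pfst) : Prop :=
  fd_shape_ok T /\
  (forall a q, (a < (fd_nin T).+2)%N -> (q < fd_nst T)%N ->
     (forall p, (p < fd_nst T)%N -> 0 <= fd_entry T a q p) /\
     \sum_(p <- iota 0 (fd_nst T)) fd_entry T a q p = 1) /\
  (forall q p, (q < fd_nst T)%N -> (p < fd_nst T)%N -> ~~ fd_halting T p ->
     fd_entry T (fd_end T) q p = 0).

Definition pfst_prob (T : pfst) (v w : seq nat) : rat :=
  let x := fd_tape T v in
  \sum_(k < size x) \sum_(p <- iota 0 (fd_nst T) | p \in fd_acc T)
     fd_weight T (rev (take k.+1 x)) p w.

Definition pfst_computes (T : pfst) (Rel : seq nat -> seq nat -> Prop) (al : rat) : Prop :=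
  forall v w, all (fun b => b < fd_nin T)%N v -> all (fun b => b < fd_nout T)%N w ->
    (Rel v w -> al <= pfst_prob T v w) /\ (~ Rel v w -> pfst_prob T v w <= 1 - al).

Definition qfst_wf (T : qfst) : Prop :=
  fd_shape_ok T /\
  (forall a, (a < (fd_nin T).+2)%N -> fd_mx T a \is unitarymx) /\
  (forall q p, (q < fd_nst T)%N -> (p < fd_nst T)%N ->
     ~~ fd_halting T q -> ~~ fd_halting T p -> fd_entry T (fd_end T) q p = 0).

Definition qfst_prob (T : qfst) (v w : seq nat) : algC :=
  let x := fd_tape T v in
  \sum_(k < size x) \sum_(p <- iota 0 (fd_nst T) | p \in fd_acc T)
     `|fd_weight T (rev (take k.+1 x)) p w| ^+ 2.

Definition qfst_computes (T : qfst) (Rel : seq nat -> seq nat -> Prop) (al : algC) : Prop :=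
  forall v w, all (fun b => b < fd_nin T)%N v -> all (fun b => b < fd_nout T)%N w ->
    (Rel v w -> al <= qfst_prob T v w) /\ (~ Rel v w -> qfst_prob T v w <= 1 - al).

Definition rel_empty K (T : fst_desc K) (Rel : seq nat -> seq nat -> Prop) : Prop :=
  forall v w, all (fun b => b < fd_nin T)%N v -> all (fun b => b < fd_nout T)%N w ->
    ~ Rel v w.

Definition fd_code (K : countType) (T : fst_desc K) : nat :=
  pickle (fd_nst T, fd_nin T, fd_nout T, fd_q0 T, fd_acc T, fd_rej T, fd_V T, fd_f T).

Definition decides_pfst_emptiness (P : seq cm_instr) : Prop :=
  forall (T : pfst) (Rel : seq nat -> seq nat -> Prop),
    pfst_wf T -> pfst_computes T Rel (2%:R / 3%:R) ->
    (rel_empty T Rel -> cm_halts_with P (fd_code T) 1) /\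
    (~ rel_empty T Rel -> cm_halts_with P (fd_code T) 0).

Definition decides_qfst_emptiness (P : seq cm_instr) : Prop :=
  forall (T : qfst) (Rel : seq nat -> seq nat -> Prop),
    qfst_wf T -> qfst_computes T Rel (2%:R / 3%:R) ->
    (rel_empty T Rel -> cm_halts_with P (fd_code T) 1) /\
    (~ rel_empty T Rel -> cm_halts_with P (fd_code T) 0).

(* Main.v *)
Require Import Defs.
From Stdlib Require Import FunctionalExtensionality.
From HB Require Import structures.
From mathcomp Require Import all_boot all_order all_algebra all_field.
From mathcomp Require Import zify ring lra.
Set Implicit Arguments. Unset Strict Implicit. Unset Printing Implicit Defensive.
Import Order.TTheory GRing.Theory Num.Theory.

(* A finite list of tiles (x_t, y_t) and a word e give a transducer that, on
   the input t_1 ... t_n, writes x_{t_1} ... x_{t_n} e, writes y_{t_1} ... y_{t_n},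
   or rejects, each with probability 1/3.  A word gets probability 2/3 when the
   two outputs agree, and at most 1/3 otherwise, so the relation computed is
   nonempty iff the correspondence problem x_I e = y_I has a solution I.  In the
   quantum machine the 1/3 comes from the first row of an orthogonal 3x3 matrix,
   and everything else is a permutation of the states.

   A counter machine is simulated by tiles in the usual way: y_I lists the
   successive configurations backwards in time, x_I their successors.  A
   configuration is a word with one head letter, in which register j is the
   number of letters [Reg j], in any order, so that an increment is one local
   rewriting and a decrement is a search by the walking head.

   For the diagonal argument, the launching tile of the machine Q writes the
   initial register contents (x, y).  The code of the transducer is an explicit
   function of (x, y) and of two numbers independent of (x, y); Q itself computes
   it from (x, y) when x and y are these two numbers, runs the alleged decision
   procedure on it, and halts iff the answer is "empty".  The
   matrices enter only one of the two numbers, so no property of the encoding of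
   [rat] or [algC] is needed. *)

(** * Programming counter machines *)

Arguments cm_step : simpl never.

Definition upd (s : nat -> nat) r x : nat -> nat := fun j => if j == r then x else s j.

Lemma upd_same s r x : upd s r x r = x.
Proof. by rewrite /upd eqxx. Qed.

Lemma upd_other s r x j : j != r -> upd s r x j = s j.
Proof. by rewrite /upd => /negbTE->. Qed.

Lemma upd_id s r : upd s r (s r) = s.
Proof. by apply: functional_extensionality => j; rewrite /upd; case: eqP => [->|]. Qed.

Lemma upd_upd s r x y : upd (upd s r x) r y = upd s r y.
Proof. by apply: functional_extensionality => j; rewrite /upd; case: eqP. Qed.

(** Structured programs spare the reasoning about program counters: the only control is a loop that
    counts a register down, decrementing it before each run of the body. *)
Inductive cmd := Skip | Inc of nat | Seq of cmd & cmd | Loop of nat & cmd.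

Inductive ev : cmd -> (nat -> nat) -> (nat -> nat) -> Prop :=
| EvSkip s : ev Skip s s
| EvInc r s : r != 0 -> ev (Inc r) s (upd s r (s r).+1)
| EvSeq c d s1 s2 s3 : ev c s1 s2 -> ev d s2 s3 -> ev (Seq c d) s1 s3
| EvLoopZ r c s : s r = 0 -> ev (Loop r c) s s
| EvLoopS r c s1 s2 s3 n : s1 r = n.+1 -> ev c (upd s1 r n) s2 ->
    ev (Loop r c) s2 s3 -> ev (Loop r c) s1 s3.

Fixpoint csize c := match c with
  | Skip => 0 | Inc _ => 1 | Seq c d => csize c + csize d | Loop _ c => (csize c).+2 end.

(* Register 0 is never incremented, so [CDec 0 off] is an unconditional jump. *)
Fixpoint compile off c : seq cm_instr := match c with
  | Skip => [::]
  | Inc r => [:: CInc r]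
  | Seq c d => compile off c ++ compile (off + csize c) d
  | Loop r c => CDec r (off + (csize c).+2) :: compile off.+1 c ++ [:: CDec 0 off]
  end.

Lemma size_compile c off : size (compile off c) = csize c.
Proof.
elim: c off => //= [c IHc d IHd|r c IHc] off; rewrite size_cat ?IHc ?IHd //=.
by rewrite addn1.
Qed.

(** Keeps the jumps [CDec 0 _] unconditional: increments avoid register 0, and a zero register never
    starts a loop body. *)
Lemma ev_reg0 c s s' : ev c s s' -> s 0 = 0 -> s' 0 = 0.
Proof.
elim=> //= {c s s'} [r s r0|c d s1 s2 s3 _ IH1 _ IH2 /IH1/IH2//
  |r c s1 s2 s3 n sr _ IH1 _ IH2 s0]; first by rewrite upd_other // eq_sym.
by apply/IH2/IH1; rewrite upd_other //; apply/eqP => r0; rewrite -r0 s0 in sr.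
Qed.

Lemma cm_step_inc P pre r post s : P = pre ++ CInc r :: post ->
  cm_step P (size pre, s) = ((size pre).+1, upd s r (s r).+1).
Proof.
move=> ->; rewrite /cm_step size_cat /= -{1}[size pre]addn0 ltn_add2l /=.
rewrite nth_cat ltnn subnn /=; congr pair.
by apply: functional_extensionality => j; rewrite /upd; case: eqP => [->|].
Qed.

Lemma cm_step_dec P pre r k post s : P = pre ++ CDec r k :: post ->
  cm_step P (size pre, s) =
  if s r == 0 then (k, s) else ((size pre).+1, upd s r (s r).-1).
Proof.
move=> ->; rewrite /cm_step size_cat /= -{1}[size pre]addn0 ltn_add2l /=.
rewrite nth_cat ltnn subnn /=; case: eqP => // _; congr pair.
by apply: functional_extensionality => j; rewrite /upd; case: eqP => [->|].
Qed.

(** Compiled jumps are absolute, so each subprogram is run in place, inside an arbitrary context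
    [pre], [post]. *)
Lemma compile_correct P c s s' : ev c s s' -> s 0 = 0 -> forall pre post,
  P = pre ++ compile (size pre) c ++ post ->
  exists n, iter n (cm_step P) (size pre, s) = (size pre + csize c, s').
Proof.
elim=> {c s s'} [s|r s r0|c d s1 s2 s3 ev1 IH1 ev2 IH2|r c s sr|r c s1 s2 s3 n sr ev1 IH1 ev2 IH2]
  s0 pre post /= EP.
- by exists 0; rewrite addn0.
- by exists 1; rewrite /= (cm_step_inc _ EP) addn1.
- have [|n1 E1] := IH1 s0 pre (compile (size pre + csize c) d ++ post).
    by rewrite EP -catA.
  have [|n2] := IH2 (ev_reg0 ev1 s0) (pre ++ compile (size pre) c) post.
    by rewrite EP size_cat size_compile !catA.
  rewrite size_cat size_compile => E2.
  by exists (n2 + n1); rewrite iterD E1 E2 addnA.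
- by exists 1; rewrite /= (cm_step_dec _ EP) sr.
have s0' : upd s1 r n 0 = 0.
  by rewrite upd_other //; apply/eqP => r0; rewrite -r0 s0 in sr.
have [|n1] := IH1 s0' (rcons pre (CDec r (size pre + (csize c).+2)))
    (CDec 0 (size pre) :: post).
  by rewrite size_rcons EP -cats1 -!catA.
rewrite size_rcons => E1; have s20 := ev_reg0 ev1 s0'.
have [n2 E2] := IH2 s20 pre post EP.
(* In order of execution: one test, [n1] steps of the body, one jump back, [n2] steps for the
   remaining rounds. *)
exists (n2 + (1 + (n1 + 1))); rewrite iterD (iterD 1) iterD /=.
rewrite (cm_step_dec _ EP) sr /= E1.
set pre2 := pre ++ CDec r (size pre + (csize c).+2) :: compile (size pre).+1 c.
have -> : (size pre).+1 + csize c = size pre2.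
  by rewrite size_cat /= size_compile addnS addSn.
have EP2 : P = pre2 ++ CDec 0 (size pre) :: post by rewrite EP /pre2 -catA /= -catA.
by rewrite (cm_step_dec _ EP2) s20.
Qed.

(** * Embedding a program into another one *)

Lemma cm_step_halted P s : size P <= s.1 -> cm_step P s = s.
Proof. by case: s => pc s /= le; rewrite /cm_step ltnNge le. Qed.

Lemma iter_cm_halted P s n : size P <= s.1 -> iter n (cm_step P) s = s.
Proof. by move=> le; elim: n => //= n ->; rewrite cm_step_halted. Qed.

(** Any jump target [k >= L] halts the program of length [L]; [minn] sends all of them to the single
    exit [off + L]. *)
Definition relocate off L m (i : cm_instr) := match i with
  | CInc r => CInc (r + m)
  | CDec r k => CDec (r + m) (off + minn k L) end.

Lemma relocate_step P Q pre post m pc reg reg' :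
  Q = pre ++ map (relocate (size pre) (size P) m) P ++ post ->
  pc < size P -> (forall j, reg' (j + m) = reg j) ->
  let s := cm_step P (pc, reg) in let s' := cm_step Q (size pre + pc, reg') in
  s'.1 = size pre + minn s.1 (size P) /\ (forall j, s'.2 (j + m) = s.2 j).
Proof.
move=> EQ lt E; rewrite /cm_step lt EQ !size_cat ltn_add2l size_map ltn_addr //.
rewrite nth_cat ltnNge leq_addr /= addKn nth_cat size_map lt (nth_map (CInc 0)) //.
case: (nth _ P pc) => [r|r k] /=.
  split; first by rewrite (minn_idPl _) // addnS.
  by move=> j; rewrite eqn_add2r E.
rewrite E; case: eqP => //= _; split; first by rewrite (minn_idPl _) // addnS.
by move=> j; rewrite eqn_add2r E.
Qed.

(** The step counts may differ: once [P] has halted it idles, whereas [Q] is stopped on reaching the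
    exit. *)
Lemma relocate_iter P Q pre post m n reg reg' :
  Q = pre ++ map (relocate (size pre) (size P) m) P ++ post ->
  (forall j, reg' (j + m) = reg j) ->
  exists n', let s := iter n (cm_step P) (0, reg) in
  let s' := iter n' (cm_step Q) (size pre, reg') in
  s'.1 = size pre + minn s.1 (size P) /\ (forall j, s'.2 (j + m) = s.2 j).
Proof.
move=> EQ E; elim: n => [|n [n' [E1 E2]]].
  by exists 0 => /=; rewrite min0n addn0.
rewrite /=; case: (ltnP (iter n (cm_step P) (0, reg)).1 (size P)) => [lt|le].
  exists n'.+1 => /=; move: E1 E2 lt.
  case: (iter n (cm_step P) (0, reg)) => pc s.
  case: (iter n' _ _) => pc' s' /= -> E2 lt.
  by rewrite (minn_idPl (ltnW lt)); exact: (relocate_step EQ lt E2).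
by exists n'; rewrite (cm_step_halted le).
Qed.

Definition cm_halts_from P s := exists n, size P <= (iter n (cm_step P) s).1.

(** Register [m] holds the output of the relocated [P]. The last instruction jumps to itself when
    this output is 0 and otherwise leaves the program. *)
Definition diag_prog (c : cmd) m (P : seq cm_instr) :=
  compile 0 c ++ map (relocate (csize c) (size P) m) P ++
  [:: CDec m (csize c + size P)].

Lemma diag_progP c m P s s' x y : ev c s s' -> s 0 = 0 ->
  (forall j, s' (j + m) = if j == 0 then x else 0) -> cm_halts_with P x y ->
  cm_halts_from (diag_prog c m P) (0, s) <-> y <> 0.
Proof.
move=> evc s0 E [n /= [le Ey]]; set Q := diag_prog c m P.
have [n1 E1] := compile_correct evc s0 (pre := [::]) (erefl : Q = _).
have EQ : Q = compile 0 c ++ map (relocate (size (compile 0 c)) (size P) m) P ++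
    [:: CDec m (csize c + size P)] by rewrite size_compile.
have [n2 /= [E2 E3]] := relocate_iter n EQ (E : forall j, _ = (cm_init x).2 j).
move: E2 E3; rewrite -/(cm_init x) (minn_idPr le) size_compile.
rewrite /= add0n in E1; rewrite -E1 -iterD; set k := _ + _ => E2 /(_ 0).
rewrite Ey add0n => E3.
have szQ : size Q = (csize c + size P).+1.
  by rewrite !size_cat size_map size_compile addn1 addnS.
case Es: (iter k (cm_step Q) (0, s)) E2 E3 => [pc t] /= E2 Et; subst pc.
have EQ2 : Q = (compile 0 c ++ map (relocate (csize c) (size P) m) P) ++
  [:: CDec m (csize c + size P)] by rewrite -catA.
have := cm_step_dec t EQ2.
rewrite size_cat size_map size_compile Et => Est.
split; last first.
  by move=> /eqP/negbTE y0; exists k.+1; rewrite iterS Es Est y0 szQ.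
move=> [l]; case: eqP Est => // y0 Est hl _.
(* A zero answer makes the last instruction a fixed point inside [Q], which contradicts halting. *)
have fixl i : iter i (cm_step Q) (csize c + size P, t) = (csize c + size P, t).
  by elim: i => //= i ->.
have := iter_cm_halted k hl; rewrite -iterD addnC iterD Es fixl => E4.
by move: hl; rewrite -E4 szQ ltnn.
Qed.

(** * Computing codes of lists in registers *)

Lemma ev_eq c s s1 s2 : ev c s s1 -> s1 =1 s2 -> ev c s s2.
Proof. by move=> H /functional_extensionality <-. Qed.

(** [G k] is the state in which the loop is tested with [k] rounds left. *)
Lemma ev_loop r c n (G : nat -> nat -> nat) s :
  s =1 G n -> (forall k, k <= n -> G k r = k) ->
  (forall k, k < n -> ev c (upd (G k.+1) r k) (G k)) -> ev (Loop r c) s (G 0).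
Proof.
move=> /functional_extensionality ->; elim: n => [|n IH] Gr Gc.
  by apply: EvLoopZ; apply: Gr.
apply: (EvLoopS (Gr _ (leqnn _)) (Gc _ (leqnn _))).
by apply: IH => k lt; [apply: Gr (leqW lt)| apply: Gc (leqW lt)].
Qed.

Ltac solve_upd := move=> ?; rewrite /upd; repeat (case: eqP => ? //); subst; try lia.

(** List cons on codes: [m] codes the tail, and 0 codes the empty list. A pair is coded as a list of
    length two. *)
Definition push (a m : nat) := 2 ^ a * m.*2.+1.

Lemma pickle_cons (K : countType) (x : K) s : pickle (x :: s) = push (pickle x) (pickle s).
Proof. by []. Qed.

Lemma pickle_pair (K L : countType) (x : K) (y : L) :
  pickle (x, y) = push (pickle x) (push (pickle y) 0).
Proof. by []. Qed.

Lemma pickle_nseq_cat (K : countType) n (x : K) s :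
  pickle (nseq n x ++ s) = iter n (push (pickle x)) (pickle s).
Proof. by elim: n => //= n IH; rewrite pickle_cons IH. Qed.

Definition tmp := 1.

Definition dbl r := Seq (Loop r (Seq (Inc tmp) (Inc tmp))) (Loop tmp (Inc r)).

Lemma ev_dbl r s : r != 0 -> r != tmp -> s tmp = 0 -> ev (dbl r) s (upd s r (s r).*2).
Proof.
move=> r0 rt st; apply: EvSeq.
  apply: (@ev_loop _ _ (s r) (fun k => upd (upd s r k) tmp (s r - k).*2)).
  - by solve_upd.
  - by move=> k _; rewrite upd_other // upd_same.
  move=> k lt; apply: ev_eq; first by apply: EvSeq; apply: EvInc.
  by solve_upd.
apply: ev_eq.
  apply: (@ev_loop _ _ (s r).*2 (fun k => upd (upd s r ((s r).*2 - k)) tmp k)).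
  - by solve_upd.
  - by move=> k _; rewrite upd_same.
  move=> k lt; apply: ev_eq; first by apply: EvInc.
  by solve_upd.
by solve_upd.
Qed.

Fixpoint rep n c := if n is n'.+1 then Seq c (rep n' c) else Skip.

Lemma ev_addc n r s : r != 0 -> ev (rep n (Inc r)) s (upd s r (s r + n)).
Proof.
move=> r0; elim: n s => [|n IH] s /=; first by rewrite addn0 upd_id; apply: EvSkip.
by apply: EvSeq; [apply: EvInc | apply: ev_eq (IH _) _; solve_upd].
Qed.

Lemma ev_dbls n r s : r != 0 -> r != tmp -> s tmp = 0 ->
  ev (rep n (dbl r)) s (upd s r (2 ^ n * s r)).
Proof.
move=> r0 rt; elim: n s => [|n IH] s st /=.
  by rewrite mul1n upd_id; apply: EvSkip.
apply: EvSeq (ev_dbl _ _ _) _ => //; apply: ev_eq (IH _ _) _.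
  by rewrite upd_other // eq_sym.
move=> j; rewrite /upd; case: eqP => // _.
by rewrite eqxx expnS -mul2n mulnCA mulnA.
Qed.

Definition push_const a r := Seq (dbl r) (Seq (Inc r) (rep a (dbl r))).

Lemma ev_push_const a r s : r != 0 -> r != tmp -> s tmp = 0 ->
  ev (push_const a r) s (upd s r (push a (s r))).
Proof.
move=> r0 rt st; apply: EvSeq (ev_dbl _ _ _) _ => //.
apply: EvSeq (EvInc _ _) _ => //; apply: ev_eq (ev_dbls _ _ _ _) _ => //.
  by rewrite !upd_other // eq_sym.
by rewrite !upd_same upd_upd => j; rewrite /upd; case: eqP.
Qed.

Definition push_reg q r := Seq (dbl r) (Seq (Inc r) (Loop q (dbl r))).

Lemma ev_push_reg q r s : q != 0 -> q != tmp -> r != 0 -> r != tmp -> q != r ->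
  s tmp = 0 -> ev (push_reg q r) s (upd (upd s r (push (s q) (s r))) q 0).
Proof.
move=> q0 qt r0 rt qr st; apply: EvSeq (ev_dbl _ _ _) _ => //.
apply: EvSeq (EvInc _ _) _ => //.
apply: ev_eq.
  apply: (@ev_loop _ _ (s q)
    (fun k => upd (upd s r (2 ^ (s q - k) * (s r).*2.+1)) q k)).
  - by rewrite subnn mul1n; solve_upd.
  - by move=> k _; rewrite upd_same.
  move=> k lt; apply: ev_eq; first apply: ev_dbl => //.
    by rewrite !upd_other // eq_sym.
  move=> j; rewrite /upd; have [->|nj] := eqVneq j r.
    by rewrite eq_sym (negbTE qr) eqxx -mul2n mulnA -expnS subnSK.
  by case: eqP.
by move=> j; rewrite subn0.
Qed.

(** The count is moved to [q'] rather than lost, because it is used once as the length of a block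
    and once more as a part of the code. *)
Definition push_loop a q q' r := Loop q (Seq (push_const a r) (Inc q')).

Lemma ev_push_loop a q q' r s : r != 0 -> r != tmp -> q' != 0 -> q' != tmp -> q != tmp ->
  q != r -> q != q' -> q' != r -> s tmp = 0 ->
  ev (push_loop a q q' r) s
     (upd (upd (upd s r (iter (s q) (push a) (s r))) q' (s q' + s q)) q 0).
Proof.
move=> r0 rt q'0 q't qt qr qq' q'r st; apply: ev_eq.
  apply: (@ev_loop _ _ (s q) (fun k => upd (upd (upd s r
     (iter (s q - k) (push a) (s r))) q' (s q' + (s q - k))) q k)).
  - by rewrite subnn /=; solve_upd.
  - by move=> k _; rewrite upd_same.
  move=> k lt; apply: ev_eq.
    apply: EvSeq; last exact: EvInc.
    by apply: ev_push_const => //; rewrite !upd_other // eq_sym.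
  move=> j; rewrite /upd.
  have [->|nj] := eqVneq j q'.
    by rewrite ?eqxx ?(negbTE q'r) ?(eq_sym q') ?(negbTE qq') ?eqxx /=; lia.
  have [->|nj'] := eqVneq j r.
    by rewrite !(eq_sym r) (negbTE qr) (negbTE q'r) eqxx -iterS subnSK.
  by case: eqP.
by move=> j; rewrite subn0.
Qed.

(* Registers 4 and 5 keep copies of 2 and 3, register 6 receives the code of the
   word [h :: nseq _ a ++ nseq _ b], and 7 that of the row starting with it. *)
Definition build a b h z :=
  Seq (push_loop b 3 5 6) (Seq (push_loop a 2 4 6) (Seq (push_const h 6)
  (Seq (rep z (Inc 7)) (Seq (push_reg 6 7) (Seq (push_reg 7 5)
  (Seq (push_reg 5 8) (push_reg 4 8))))))).

Definition regs2 x y := upd (upd (fun=> 0) 2 x) 3 y.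

(** Register 8 becomes register 0 of the program relocated by 8, and the registers above it are
    still zero, so that program starts in its initial state. *)
Lemma ev_build a b h z x y : exists2 s, ev (build a b h z) (regs2 x y) s &
  forall j, s (j + 8) = if j == 0 then
    push x (push (push (push (push h (iter x (push a) (iter y (push b) 0))) z) y) 0) else 0.
Proof.
eexists.
  do 7![apply: EvSeq;
    [by [apply: ev_push_loop|apply: ev_push_const|apply: ev_addc|apply: ev_push_reg]|]].
  by apply: ev_push_reg.
by case=> [|j] //; rewrite (addnC j.+1).
Qed.

(** * Tiles and the correspondence problem *)

Section Tiles.
Variable A : eqType.
Implicit Types (ts K : seq (seq A * seq A)).

Definition tops K := flatten (map fst K).
Definition bots K := flatten (map snd K).

Lemma tops_cat K1 K2 : tops (K1 ++ K2) = tops K1 ++ tops K2.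
Proof. by rewrite /tops map_cat flatten_cat. Qed.

Lemma bots_cat K1 K2 : bots (K1 ++ K2) = bots K1 ++ bots K2.
Proof. by rewrite /bots map_cat flatten_cat. Qed.

(** Post correspondence with a fixed word closing the top row. [K] may be empty, which solves the
    case of an empty [c]. *)
Definition solvable ts c := exists2 K, {subset K <= ts} & tops K ++ c = bots K.

Lemma cat_le_size (s1 s2 t1 t2 : seq A) : s1 ++ s2 = t1 ++ t2 ->
  size s1 <= size t1 -> exists2 d, t1 = s1 ++ d & s2 = d ++ t2.
Proof.
elim: s1 t1 => [|a s1 IH] [|b t1] //=; [by exists [::] | by exists (b :: t1) |].
by case=> -> /IH{}IH /IH[d -> ->]; exists d.
Qed.

(** A bottom can contain [b] only as its first letter, so every occurrence of [b] in the bottom row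
    is a tile boundary. *)
Lemma bots_split ts b K x y : {in ts, forall t, b \notin behead t.2} ->
  {subset K <= ts} -> bots K = x ++ b :: y ->
  exists K1 K2, [/\ K = K1 ++ K2, bots K1 = x & bots K2 = b :: y].
Proof.
move=> tsb; elim: K x => [|t K IH] x sK; first by case: x.
have sK' : {subset K <= ts} by move=> z zK; apply: sK; rewrite inE zK orbT.
have := tsb t (sK _ (mem_head _ _)).
case: x => [|a x] bt E; first by exists [::], (t :: K).
have E' : t.2 ++ bots K = (a :: x) ++ b :: y by rewrite -[LHS]/(bots (t :: K)).
case: (leqP (size t.2) (size (a :: x))) => [le|lt]; last first.
  have [[|b' d] Ed Eb] := cat_le_size (esym E') (ltnW lt).
    by move: lt; rewrite Ed cats0 ltnn.
  by case: Eb bt => -> _; rewrite Ed /= mem_cat inE eqxx orbT.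
have [d Ex Ed] := cat_le_size E' le.
have [K1 [K2 [-> E1 E2]]] := IH d sK' Ed.
by exists (t :: K1), K2; split=> //; rewrite Ex -E1.
Qed.

(** Cutting the bottom row just before [b :: c] isolates the tiles [K2] covering this word; the
    shorter list [K1] is then a solution for the word above them. *)
Lemma solution_step ts b K c : {in ts, forall t, b \notin behead t.2} ->
  {subset K <= ts} -> tops K ++ b :: c = bots K ->
  exists K1 K2, [/\ size K1 < size K, {subset K1 <= ts}, {subset K2 <= ts},
    bots K2 = b :: c & tops K1 ++ tops K2 = bots K1].
Proof.
move=> tsb sK /esym E; have [K1 [K2 [EK E1 E2]]] := bots_split tsb sK E.
exists K1, K2; rewrite E1 E2 EK tops_cat size_cat; split=> //.
- by case: (K2) E2 => //= *; rewrite -addSnnS leq_addr.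
- by move=> z zK; apply: sK; rewrite EK mem_cat zK.
- by move=> z zK; apply: sK; rewrite EK mem_cat zK orbT.
Qed.

(** The right-hand side has [h] as its only head, so the head inside the prefix [l] is this one. *)
Lemma first_head (hd : pred A) u h v l s :
  hd h -> ~~ has hd u -> ~~ has hd v -> count hd l = 1 -> l ++ s = u ++ h :: v ->
  exists2 l2, l = u ++ h :: l2 & v = l2 ++ s.
Proof.
move=> hh; elim: u l => [|a u IH] [|a' l] //=.
  move=> _ nv; case: (boolP (hd a')) => [ha' [cl]|na c1] [Ea Es]; last by rewrite Ea hh in na.
  by exists l => //; rewrite Ea.
rewrite negb_or => /andP[na nu] nv; rewrite -(negbK (hd a')) => c1 [Ea Es].
move: c1; rewrite Ea na /= add0n => c1.
have [l2 -> ->] := IH l nu nv c1 Es.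
by exists l2.
Qed.

(** A tile either copies a headless word or has one head in its bottom. A word with one head is thus
    covered by copies and a single rewriting tile. *)
Lemma bots_parse (hd : pred A) ts K u h v :
  {in ts, forall t, (t.1 == t.2) && ~~ has hd t.2 || (count hd t.2 == 1)} ->
  {subset K <= ts} -> hd h -> ~~ has hd u -> ~~ has hd v -> bots K = u ++ h :: v ->
  exists x l1 l2 y r, [/\ (r, l1 ++ h :: l2) \in ts, u = x ++ l1, v = l2 ++ y &
    tops K = x ++ r ++ y].
Proof.
move=> tsP; elim: K u => [|t K IH] u sK hh nu nv; first by case: u {nu}.
have tts : t \in ts by apply/sK/mem_head.
have sK' : {subset K <= ts} by move=> z zK; apply: sK; rewrite inE zK orbT.
rewrite -[bots _]/(t.2 ++ bots K) => E.
have := tsP t tts; case/orP => [/andP[/eqP Et nt]|/eqP ct].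
  have le : size t.2 <= size u.
    rewrite leqNgt; apply/negP => lt; case/negP: nt.
    have [[|h' d] Ed Eh] := cat_le_size (esym E) (ltnW lt).
      by move: lt; rewrite Ed cats0 ltnn.
    by case: Eh => Eh _; rewrite Ed has_cat /= -Eh hh orbT.
  have [d Eu Ed] := cat_le_size E le.
  have [|x [l1 [l2 [y [r [H1 H2 H3 H4]]]]]] := IH d sK' hh _ nv Ed.
    by move: nu; rewrite Eu has_cat negb_or => /andP[].
  exists (t.2 ++ x), l1, l2, y, r; split=> //; first by rewrite Eu H2 catA.
  by rewrite -[tops _]/(t.1 ++ tops K) H4 Et catA.
have [l2 El Ev] := first_head hh nu nv ct E.
exists [::], u, l2, (bots K), t.1; split=> //; first by rewrite -El -surjective_pairing.
(* The only head has been consumed, so all remaining tiles are copies. *)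
suff -> : bots K = tops K by [].
have : ~~ has hd (bots K) by apply: contra nv; rewrite Ev has_cat orbC => ->.
elim: K sK' {IH sK E Ev} => //= t' K IH sK.
have sK' : {subset K <= ts} by move=> z zK; apply: sK; rewrite inE zK orbT.
rewrite -[bots _]/(t'.2 ++ bots K) -[tops _]/(t'.1 ++ tops K).
rewrite has_cat negb_or => /andP[nt /(IH sK')->].
have /orP[/andP[/eqP-> //]|] := tsP t' (sK _ (mem_head _ _)).
by move: nt; rewrite has_count => /negP; case: (count hd t'.2) => // n [].
Qed.

(** The solution is prolonged by copies of [x], the tile [(r, l)] and copies of [y]: their top row
    supplies the old closing word, and their bottom row matches the new one. *)
Lemma solvable_rule ts x l r y : {in x ++ y, forall a, ([:: a], [:: a]) \in ts} ->
  (r, l) \in ts -> solvable ts (x ++ r ++ y) -> solvable ts (x ++ l ++ y).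
Proof.
move=> xy rl [K sK E]; pose cp := map (fun a : A => ([:: a], [:: a])).
have tcp z : tops (cp z) = z by elim: z => //= a z IH; rewrite -{2}IH.
have bcp z : bots (cp z) = z by elim: z => //= a z IH; rewrite -{2}IH.
exists (K ++ cp x ++ (r, l) :: cp y).
  move=> t; rewrite !(mem_cat, inE) => /or3P[/sK //|/mapP[a ax ->]|/orP[/eqP-> //|/mapP[a ay ->]]];
    by apply: xy; rewrite mem_cat ?ax ?ay ?orbT.
rewrite !tops_cat !bots_cat tcp bcp -[tops (_ :: _)]/(r ++ tops (cp y)).
by rewrite -[bots (_ :: _)]/(l ++ bots (cp y)) tcp bcp -E !catA.
Qed.

End Tiles.

(** * Counter machines as tiles *)

(** [Bot] and [Top] delimit a configuration. [Head p] executes instruction [p], possibly walking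
    right in a search; [Back p] walks left to resume at [p]. *)
Inductive sym := Start | Bot | Top | Reg of nat | Head of nat | Back of nat.

(** The three families occupy distinct residues modulo 3, above the codes 0, 1, 2. *)
Definition enc a := match a with
  | Start => 0 | Bot => 1 | Top => 2
  | Reg j => (3 * j).+3 | Head p => (3 * p).+4 | Back p => (3 * p).+4.+1 end.

Lemma enc_inj : injective enc.
Proof. by case=> [|||j|p|p] [|||j'|p'|p'] //=; try lia; move=> E; congr (_ _); lia. Qed.

HB.instance Definition _ := Equality.copy sym (inj_type enc_inj).

Definition is_head a := match a with Start | Head _ | Back _ => true | _ => false end.

Section MachineTiles.
Variables (Q : seq cm_instr) (k M : nat) (init : seq nat).

(** Tiles are read from bottom to top. A decrement passes the letters other than [Reg r]; it deletes
    the first [Reg r] it meets, or finds the register empty on reaching [Top]. *)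
Definition instr_tiles p i : seq (seq sym * seq sym) := match i with
  | CInc r => [:: ([:: Head p.+1; Reg r], [:: Head p])]
  | CDec r q => [:: ([:: Back q; Top], [:: Head p; Top]);
                    ([:: Back p.+1], [:: Head p; Reg r])] ++
      [seq ([:: Reg j; Head p], [:: Head p; Reg j]) | j <- iota 0 k & j != r] end.

(** A halted head eats the register letters and finally erases the whole configuration, which closes
    the correspondence. *)
Definition halt_tiles p := ([::], [:: Bot; Head p; Top]) ::
  [seq ([:: Head p], [:: Head p; Reg j]) | j <- iota 0 k].

Definition head_tiles p :=
  if p < size Q then instr_tiles p (nth (CInc 0) Q p) else halt_tiles p.

Definition back_tiles q := ([:: Bot; Head q], [:: Bot; Back q]) ::
  [seq ([:: Back q; Reg j], [:: Reg j; Back q]) | j <- iota 0 k].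

Definition copy_tiles : seq (seq sym * seq sym) :=
  ([:: Bot], [:: Bot]) :: ([:: Top], [:: Top]) ::
  [seq ([:: Reg j], [:: Reg j]) | j <- iota 0 k].

Definition base_tiles :=
  copy_tiles ++ flatten [seq head_tiles p ++ back_tiles p | p <- iota 0 M].

Definition start_tile : seq sym * seq sym := (Head 0 :: map Reg init, [:: Start]).

Definition tiles := start_tile :: base_tiles.

Lemma mem_tiles t : t \in tiles ->
  [\/ t = start_tile, t \in copy_tiles, exists p, t \in head_tiles p |
      exists p, t \in back_tiles p].
Proof.
rewrite inE => /orP[/eqP->|]; first by constructor 1.
rewrite mem_cat => /orP[->|]; first by constructor 2.
case/flatten_mapP=> p _; rewrite mem_cat => /orP[tp|tp]; [constructor 3|constructor 4]; by exists p.
Qed.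

Lemma head_tilesP p t : t \in head_tiles p ->
  (filter is_head t.2 = [:: Head p]) /\ (Bot \notin behead t.2).
Proof.
rewrite /head_tiles; case: ifP => _.
  case: (nth _ _ _) => [r|r q] /=; first by rewrite inE => /eqP->.
  by rewrite !inE => /or3P[/eqP->|/eqP->|/mapP[j _ ->]].
by rewrite inE => /orP[/eqP->|/mapP[j _ ->]].
Qed.

Lemma back_tilesP p t : t \in back_tiles p ->
  (filter is_head t.2 = [:: Back p]) /\ (Bot \notin behead t.2).
Proof. by rewrite inE => /orP[/eqP->|/mapP[j _ ->]]. Qed.

Lemma copy_tilesP t : t \in copy_tiles ->
  [/\ t.1 = t.2, filter is_head t.2 = [::] & Bot \notin behead t.2].
Proof. by rewrite !inE => /or3P[/eqP->|/eqP->|/mapP[j _ ->]]. Qed.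

Lemma tiles_bot : {in tiles, forall t, Bot \notin behead t.2}.
Proof.
move=> t /mem_tiles[->|/copy_tilesP[]|[p /head_tilesP[]]|[p /back_tilesP[]]] //.
Qed.

Lemma tiles_heads : {in tiles, forall t,
  (t.1 == t.2) && ~~ has is_head t.2 || (count is_head t.2 == 1)}.
Proof.
move=> t; rewrite has_count -size_filter.
by case/mem_tiles=> [->|/copy_tilesP[-> -> _]|[p /head_tilesP[-> _]]|[p /back_tilesP[-> _]]];
  rewrite ?eqxx ?orbT.
Qed.

(** A bottom contains at most one head, and this head determines the family of the tile. *)
Lemma head_tile r l1 h l2 : (r, l1 ++ h :: l2) \in tiles -> is_head h -> match h with
  | Head p => (r, l1 ++ h :: l2) \in head_tiles p
  | Back p => (r, l1 ++ h :: l2) \in back_tiles p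
  | _ => (r, l1 ++ h :: l2) = start_tile end.
Proof.
move=> tt hh; have hf : h \in filter is_head (r, l1 ++ h :: l2).2.
  by rewrite mem_filter hh mem_cat inE eqxx orbT.
case/mem_tiles: tt => [E|/copy_tilesP[_ E _]|[p tp]|[p tp]].
- by move: hf; rewrite E inE => /eqP->.
- by move: hf; rewrite E.
- by move: hf; rewrite (head_tilesP tp).1 inE => /eqP Eh; subst h.
- by move: hf; rewrite (back_tilesP tp).1 inE => /eqP Eh; subst h.
Qed.

(** * From solutions to halting runs *)

Definition config u h v := Bot :: map Reg u ++ h :: map Reg v ++ [:: Top].

Definition holds (w : seq nat) (reg : nat -> nat) := forall j, count_mem j w = reg j.

(* A head strictly inside the word is looking for [Reg r] and has not met it on its left. *)
Inductive cfg : seq sym -> cm_state -> Prop :=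
| CfgHead u v pc reg : holds (u ++ v) reg ->
    u = [::] \/ (exists r q, [/\ pc < size Q, nth (CInc 0) Q pc = CDec r q & r \notin u]) ->
    cfg (config u (Head pc) v) (pc, reg)
| CfgBack u v pc reg : holds (u ++ v) reg -> cfg (config u (Back pc) v) (pc, reg).

Lemma has_map_Reg u : has is_head (map Reg u) = false.
Proof. by elim: u. Qed.

Lemma mem_map_Reg u : (Bot \in map Reg u) = false.
Proof. by elim: u. Qed.

Lemma config_parse K u h v : {subset K <= tiles} -> is_head h -> bots K = config u h v ->
  exists x l1 l2 y r, [/\ match h with
  | Head p => (r, l1 ++ h :: l2) \in head_tiles p
  | Back p => (r, l1 ++ h :: l2) \in back_tiles p
  | _ => (r, l1 ++ h :: l2) = start_tile end, Bot :: map Reg u = x ++ l1,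
     map Reg v ++ [:: Top] = l2 ++ y & tops K = x ++ r ++ y].
Proof.
move=> sK hh E; have := bots_parse tiles_heads sK hh _ _ (E : _ = (Bot :: map Reg u) ++ _).
rewrite /= has_cat !has_map_Reg => /(_ isT isT) [x [l1 [l2 [y [r [rt Eu Ev ->]]]]]].
by exists x, l1, l2, y, r; split=> //; apply: head_tile.
Qed.

Lemma cat_cons1 (A : Type) (l1 : seq A) h l2 a : l1 ++ h :: l2 = [:: a] ->
  [/\ l1 = [::], h = a & l2 = [::]].
Proof. by case: l1 => [|? [|? ?]] //= [-> ->]. Qed.

Lemma cat_cons2 (A : Type) (l1 : seq A) h l2 a b : l1 ++ h :: l2 = [:: a; b] ->
  [/\ l1 = [::], h = a & l2 = [:: b]] \/ [/\ l1 = [:: a], h = b & l2 = [::]].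
Proof.
case: l1 => [|? [|? l]] /= [-> E]; first by left.
  by case: E => -> ->; right.
by case: l E.
Qed.

(** The first alternative covers the moves of a walking head, which leave the machine state
    unchanged. *)
Lemma cfg_step c s K : cfg c s -> s.1 < size Q -> {subset K <= tiles} -> bots K = c ->
  cfg (tops K) s \/ cfg (tops K) (cm_step Q s).
Proof.
case=> {c s} [u v pc reg hw uP|u v pc reg hw] /= lt sK E; last first.
  have [x [l1 [l2 [y [r [rt Eu Ev ->]]]]]] := config_parse (h := Back pc) sK isT E.
  left; move: rt; rewrite inE => /orP[/eqP[-> H]|/mapP[j _ [-> H]]].
    have [[_ //]|[? _ ?]] := cat_cons2 H; subst l1 l2; rewrite /= in Ev.
    case: x Eu => [|b x] /= [] => [Eu|_ Eu].
      by case: u Eu hw E => // _ hw E; rewrite -Ev; apply: (@CfgHead [::] v) => //; left.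
    by have := congr1 (fun w => Bot \in w) Eu; rewrite mem_cat inE eqxx orbT mem_map_Reg.
  have [[_ //]|[? _ ?]] := cat_cons2 H; subst l1 l2; rewrite /= in Ev.
  rewrite -Ev; case/lastP: u Eu hw {E} => [|u b]; first by case: x => [|? []].
  rewrite map_rcons -cats1 -cat_cons => /eqP.
  rewrite !cats1 eqseq_rcons => /andP[/eqP<- /eqP[<-]] hw.
  by rewrite -cats1; apply: (@CfgBack u (b :: v)); rewrite -cat_rcons.
have [x [l1 [l2 [y [r [rt Eu Ev ->]]]]]] := config_parse (h := Head pc) sK isT E.
move: rt; rewrite /head_tiles lt /cm_step lt /=.
case Ei: (nth _ _ _) => [j|j q] /=.
  right; move: rt; rewrite inE => /eqP[-> H].
  have [? _ ?] := cat_cons1 H; subst l1 l2; rewrite /= in Ev.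
  (* Only a decrement lets the head stand inside the word, so here it is at the left end. *)
  case: uP hw Eu {E} => [-> hw|[? [? [_]]]]; last by rewrite Ei.
  rewrite cats0 => <-; rewrite -Ev; apply: (@CfgHead [::] (j :: v)); last by left.
  by move=> i /=; rewrite -hw eq_sym /=; case: eqP.
rewrite !inE => /or3P[/eqP[-> H]|/eqP[-> H]|/mapP[i]].
- right; have [[? _ ?]|[_ //]] := cat_cons2 H; subst l1 l2.
  case: v Ev hw {E} => [|b v] //= [Ey] hw; subst y.
  (* The search has reached [Top] without meeting [Reg j] on its way, so the register is zero. *)
  have nj : j \notin u by case: uP => [->//|[r' [q' [_]]]]; rewrite Ei => -[-> _].
  have -> : reg j == 0 by rewrite -hw cats0; apply/eqP/count_memPn.
  by rewrite cats0 in Eu; rewrite -Eu; apply: (@CfgBack u [::]).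
- right; have [[? _ ?]|[_ //]] := cat_cons2 H; subst l1 l2.
  case: v Ev hw {E} => [|b v] //= [Eb Ev] hw; subst b.
  have -> : reg j == 0 = false by rewrite -hw count_cat /= eqxx addnC.
  rewrite cats0 in Eu; rewrite -Eu -Ev; apply: (@CfgBack u v) => i.
  rewrite -!hw !count_cat /=; have [->|nij] := eqVneq i j; first by lia.
  by [].
rewrite mem_filter => /andP[nij _] [-> H]; left.
have [[? _ ?]|[_ //]] := cat_cons2 H; subst l1 l2.
case: v Ev hw {E} => [|b v] //= [Eb Ev] hw; subst b.
rewrite cats0 in Eu; rewrite -Eu -Ev.
have := @CfgHead (rcons u i) v pc reg; rewrite /config map_rcons !cat_rcons; apply=> //.
right; exists j, q; split=> //; rewrite mem_rcons inE negb_or eq_sym nij.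
by case: uP => [->//|[r' [q' [_]]]]; rewrite Ei => -[-> _].
Qed.

(** Each configuration consumes at least one tile of a finite solution, so the run cannot go on
    forever. *)
Lemma cfg_halts c s K : cfg c s -> {subset K <= tiles} -> tops K ++ c = bots K ->
  cm_halts_from Q s.
Proof.
have [n] := ubnP (size K); elim: n c s K => // n IH c s K ltn cs sK E.
case: (leqP (size Q) s.1) => [le|lt]; first by exists 0.
have [c' Ec] : exists c', c = Bot :: c' by case: cs => *; eexists.
rewrite Ec in E; have [K1 [K2 [lt1 sK1 sK2 E2 E1]]] := solution_step tiles_bot sK E.
have lt1n : size K1 < n by apply: leq_trans lt1 _.
rewrite -Ec in E2; have [cs'|cs'] := cfg_step cs lt sK2 E2.
  exact: IH cs' sK1 E1.
have [i le] := IH _ _ _ lt1n cs' sK1 E1; exists i.+1.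
by rewrite iterSr.
Qed.

Lemma solvable_halts : solvable tiles [:: Bot; Start; Top] ->
  cm_halts_from Q (0, fun j => count_mem j init).
Proof.
case=> K sK E; have [K1 [K2 [_ sK1 sK2 E2 E1]]] := solution_step tiles_bot sK E.
apply: cfg_halts sK1 E1.
(* Only the launching tile has [Start] in its bottom, so the word above the end word is the initial
   configuration. *)
have [x [l1 [l2 [y [r [[-> El] Eu Ev ->]]]]]] :=
  config_parse (u := [::]) (h := Start) (v := [::]) sK2 isT E2.
have [? _ ?] := cat_cons1 El.
subst l1 l2; rewrite cats0 in Eu; rewrite /= in Ev; rewrite -Eu -Ev.
by apply: (@CfgHead [::] init) => //; left.
Qed.

(** * From halting runs to solutions *)

Definition instr_ok i := match i with
  | CInc r => r < k
  | CDec r q => (r < k) && (q < M) end.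

Hypotheses (Q_ok : all instr_ok Q) (ltQM : size Q < M) (init_ok : all (ltn^~ k) init).

Lemma mem_iota0 j n : j < n -> j \in iota 0 n.
Proof. by rewrite mem_iota. Qed.

Lemma copy_in_tiles u v s1 s2 : all (ltn^~ k) (u ++ v) -> {subset s1 <= [:: Bot]} ->
  {subset s2 <= [:: Top]} ->
  {in (s1 ++ map Reg u) ++ map Reg v ++ s2, forall a, ([:: a], [:: a]) \in tiles}.
Proof.
move=> /allP uv s1P s2P a aw; rewrite inE mem_cat; apply/orP; right; apply/orP; left.
move: aw; rewrite !mem_cat -orbA => /or4P[/s1P|/mapP[j ju ->]|/mapP[j jv ->]|/s2P].
- by rewrite inE => /eqP->.
- by apply/orP; right; apply/orP; right; apply/map_f/mem_iota0/uv; rewrite mem_cat ju.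
- by apply/orP; right; apply/orP; right; apply/map_f/mem_iota0/uv; rewrite mem_cat jv orbT.
- by rewrite inE => /eqP->.
Qed.

Lemma head_in_tiles p t : p < M -> t \in head_tiles p -> t \in tiles.
Proof.
move=> pM tp; rewrite inE mem_cat; apply/orP; right; apply/orP; right.
by apply/flatten_mapP; exists p; rewrite ?mem_iota0 // mem_cat tp.
Qed.

Lemma back_in_tiles p t : p < M -> t \in back_tiles p -> t \in tiles.
Proof.
move=> pM tp; rewrite inE mem_cat; apply/orP; right; apply/orP; right.
by apply/flatten_mapP; exists p; rewrite ?mem_iota0 // mem_cat tp orbT.
Qed.

(** Solvability is pulled back along the leftward walk, one letter of [u] at a time from its right
    end. *)
Lemma solvable_back q u v : q < M -> all (ltn^~ k) (u ++ v) ->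
  solvable tiles (config [::] (Head q) (u ++ v)) -> solvable tiles (config u (Back q) v).
Proof.
move=> qM; elim/last_ind: u v => [|u j IH] v uv H.
  apply: (@solvable_rule _ _ [::] [:: Bot; Back q] [:: Bot; Head q] (map Reg v ++ [:: Top])) => //.
    exact: (@copy_in_tiles [::] v [::] [:: Top]).
  by apply: (back_in_tiles qM); rewrite inE eqxx.
move: uv H; rewrite cat_rcons => uv H.
have jk : j < k by apply: (allP uv); rewrite mem_cat inE eqxx orbT.
have := IH _ uv H; rewrite /config map_rcons cat_rcons /= -!cat_cons.
apply: (@solvable_rule _ _ (Bot :: map Reg u) [:: Reg j; Back q] [:: Back q; Reg j]).
  by apply: (@copy_in_tiles u v [:: Bot] [:: Top]) => //;
    move: uv; rewrite !all_cat /= => /and3P[-> _ ->].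
by apply: (back_in_tiles qM); rewrite inE; apply/orP; right;
  apply/mapP; exists j; rewrite ?mem_iota0.
Qed.

Lemma solvable_halt p w : size Q <= p -> p < M -> all (ltn^~ k) w ->
  solvable tiles (config [::] (Head p) w).
Proof.
move=> Qp pM; have tp t : t \in halt_tiles p -> t \in tiles.
  by move=> tp; apply: (head_in_tiles pM); rewrite /head_tiles ltnNge Qp.
elim: w => [|j w IH] /=.
  move=> _; apply: (@solvable_rule _ _ [::] [:: Bot; Head p; Top] [::] [::]) => //.
    by apply: tp; rewrite inE eqxx.
  by exists [::].
move=> /andP[jk wk].
apply: (@solvable_rule _ _ [:: Bot] [:: Head p; Reg j] [:: Head p] (map Reg w ++ [:: Top])).
- exact: (@copy_in_tiles [::] w [:: Bot]).
- by apply: tp; rewrite inE; apply/orP; right; apply/mapP; exists j; rewrite ?mem_iota0.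
exact: IH.
Qed.

(** Induction on the part [v] still to be searched; in both outcomes the head first returns to the
    left end. *)
Lemma solvable_dec p r q u v : p < size Q -> nth (CInc 0) Q p = CDec r q ->
  all (ltn^~ k) (u ++ v) ->
  solvable tiles (if r \in v then config [::] (Head p.+1) (u ++ rem r v)
                  else config [::] (Head q) (u ++ v)) ->
  solvable tiles (config u (Head p) v).
Proof.
move=> pQ Ep; have pM := ltn_trans pQ ltQM.
have tp t : t \in instr_tiles p (CDec r q) -> t \in tiles.
  by move=> tp; apply: (head_in_tiles pM); rewrite /head_tiles pQ Ep.
have /andP[rk qM] : instr_ok (CDec r q) by rewrite -Ep; apply: (all_nthP (CInc 0) Q_ok).
elim: v u => [|j v IH] u uv.
  move=> /solvable_back => /(_ qM uv); rewrite /config /= -!cat_cons.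
  apply: (@solvable_rule _ _ (Bot :: map Reg u) [:: Head p; Top] [:: Back q; Top] [::]).
    exact: (@copy_in_tiles u [::] [:: Bot] [::]).
  by apply: tp; rewrite inE eqxx.
rewrite inE eq_sym /=; have [Ej|nj] := eqVneq j r; rewrite /=.
  subst j; have uv' : all (ltn^~ k) (u ++ v) by move: uv; rewrite !all_cat /= => /and3P[-> _ ->].
  (* The target [p.+1] may equal [size Q], the halting position, which is why [M] exceeds
     [size Q]. *)
  move=> /solvable_back => /(_ (leq_ltn_trans pQ ltQM) uv'); rewrite /config /= -!cat_cons.
  apply: (@solvable_rule _ _ (Bot :: map Reg u) [:: Head p; Reg r] [:: Back p.+1]).
    exact: (@copy_in_tiles u v [:: Bot] [:: Top]).
  by apply: tp; rewrite !inE eqxx orbT.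
rewrite -!cat_rcons => H; have := IH (rcons u j).
rewrite !cat_rcons => /(_ uv); rewrite -!cat_rcons => /(_ H).
rewrite /config map_rcons cat_rcons -cat_cons.
apply: (@solvable_rule _ _ (Bot :: map Reg u) [:: Head p; Reg j] [:: Reg j; Head p]).
  by apply: (@copy_in_tiles u v [:: Bot] [:: Top]) => //;
    move: uv; rewrite !all_cat /= => /and3P[-> _ ->].
apply: tp; rewrite !inE; apply/orP; right; apply/orP; right; apply/mapP; exists j => //.
rewrite mem_filter nj mem_iota0 //=; apply: (allP uv).
by rewrite mem_cat inE eqxx orbT.
Qed.

Lemma solvable_run n p reg w : p < M -> all (ltn^~ k) w -> holds w reg ->
  size Q <= (iter n (cm_step Q) (p, reg)).1 -> solvable tiles (config [::] (Head p) w).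
Proof.
elim: n p reg w => [|n IH] p reg w pM wk hw.
  by move=> le; apply: solvable_halt.
case: (ltnP p (size Q)) => [pQ|le _]; last exact: solvable_halt.
rewrite iterSr /cm_step pQ -/(cm_step Q); case Ep: (nth _ _ _) => [r|r q].
  have rk : instr_ok (CInc r) by rewrite -Ep; apply: (all_nthP (CInc 0) Q_ok).
  move=> /IH => /(_ (r :: w)) H.
  apply: (@solvable_rule _ _ [:: Bot] [:: Head p] [:: Head p.+1; Reg r] (map Reg w ++ [:: Top])).
  - exact: (@copy_in_tiles [::] w [:: Bot]).
  - by apply: (head_in_tiles pM); rewrite /head_tiles pQ Ep inE eqxx.
  apply: H; [exact: leq_ltn_trans pQ ltQM | by apply/andP |].
  by move=> i /=; rewrite -hw eq_sym; case: eqP.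
have /andP[rk qM] : instr_ok (CDec r q) by rewrite -Ep; apply: (all_nthP (CInc 0) Q_ok).
have rw : (r \in w) = (reg r != 0) by rewrite -hw -lt0n -has_count has_pred1.
move=> H; apply: (solvable_dec pQ Ep) => //; rewrite rw; move: H.
case: eqP => r0 H /=; first exact: IH H.
apply: IH H; first exact: leq_ltn_trans pQ ltQM.
  by apply/allP => i /mem_rem /(allP wk).
move=> i; rewrite count_rem -hw rw; move: r0 => /eqP-> /=.
by rewrite eq_sym; case: eqP => _; rewrite ?subn1 ?subn0 // -hw.
Qed.

Lemma solvableP : solvable tiles [:: Bot; Start; Top] <->
  cm_halts_from Q (0, fun j => count_mem j init).
Proof.
split; first exact: solvable_halts.
case=> n /solvable_run => /(_ init) H.
have := H (leq_ltn_trans (leq0n _) ltQM) init_ok (fun=> erefl).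
rewrite /config /= -cat_cons.
apply: (@solvable_rule _ _ [:: Bot] [:: Start] (Head 0 :: map Reg init) [:: Top]).
  exact: (@copy_in_tiles [::] [::] [:: Bot] [:: Top]).
by rewrite inE eqxx.
Qed.
End MachineTiles.

(** * Transducers from tiles *)

Section TileTransducer.
Variables (K : nzRingType) (c : K) (S E : seq (seq K)).
Variables (N : nat) (ts : seq (seq nat * seq nat)) (e : seq nat).
Local Open Scope ring_scope.

Definition unit_row j : seq K := [seq (i == j)%:R | i <- iota 0 6].

Definition tile_row (t : seq nat * seq nat) := [:: t.1; t.2; [::]; [::]; [::]; [::]].

(* States 0 and 1 write the first and second components of the tiles, 2 writes
   nothing; the end marker sends them to 3, 4 (accepting) and 5 (rejecting). *)
Definition tile_fst : fst_desc K := FstDesc 6 (size ts) N 0 [:: 3; 4] [:: 5]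
  (nseq (size ts) (map unit_row (iota 0 6)) ++ [:: S; E])
  (map tile_row ts ++ [:: nseq 6 [::]; tile_row (e, [::])]).

Hypothesis S_row : nth [::] S 0 = [:: c; c; c; 0; 0; 0].
Hypothesis E_row : forall i, (i < 3)%N -> nth [::] E i = unit_row (i + 3)%N.

Local Notation T := tile_fst.

Lemma entry_letter a q p : (a < size ts)%N -> (q < 6)%N -> (p < 6)%N ->
  fd_entry T a q p = (p == q)%:R.
Proof.
move=> la lq lp; rewrite /fd_entry nth_cat size_nseq la nth_nseq la.
by rewrite (nth_map 0) ?size_iota // nth_iota // (nth_map 0) ?size_iota // nth_iota.
Qed.

Lemma entry_start q p : fd_entry T (fd_start T) q p = nth 0 (nth [::] S q) p.
Proof. by rewrite /fd_entry /fd_start nth_cat size_nseq ltnn subnn. Qed.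

Lemma entry_end q p : fd_entry T (fd_end T) q p = nth 0 (nth [::] E q) p.
Proof. by rewrite /fd_entry /fd_end nth_cat size_nseq ltnNge leqnSn /= subSnn. Qed.

Lemma out_letter a q : (a < size ts)%N ->
  fd_out T a q = nth [::] (tile_row (nth ([::], [::]) ts a)) q.
Proof. by move=> la; rewrite /fd_out nth_cat size_map la (nth_map ([::], [::])). Qed.

Lemma out_start q : fd_out T (fd_start T) q = [::].
Proof.
rewrite /fd_out /fd_start nth_cat size_map ltnn subnn.
by do 7![case: q => [|q] //].
Qed.

Lemma out_end q : fd_out T (fd_end T) q = nth [::] (tile_row (e, [::])) q.
Proof. by rewrite /fd_out /fd_end nth_cat size_map ltnNge leqnSn /= subSnn. Qed.

Definition outputs v q := flatten [seq nth [::] (tile_row (nth ([::], [::]) ts a)) q | a <- v].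

Lemma sum_iota_single n p (F : nat -> K) : (p < n)%N ->
  (forall q, (q < n)%N -> q != p -> F q = 0) -> \sum_(q <- iota 0 n) F q = F p.
Proof.
move=> lp F0; rewrite (bigD1_seq p) ?iota_uniq ?mem_iota //= big1_seq ?addr0 // => q.
by rewrite mem_iota => /andP[nqp lq]; apply: F0.
Qed.

Lemma weight_cons a r p u : r != [::] -> fd_weight T (a :: r) p u =
  \sum_(q <- iota 0 6) (if suffix (fd_out T a q) u && ~~ fd_halting T q
    then fd_weight T r q (take (size u - size (fd_out T a q)) u) * fd_entry T a q p else 0).
Proof. by move=> r0; rewrite /= r0. Qed.

(** The guard and the truncation in [fd_weight] together express that the output [u] is [t] followed
    by [s]. *)
Lemma suffix_take (s t u : seq nat) :
  suffix s u && (take (size u - size s) u == t) = (u == t ++ s).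
Proof.
apply/andP/eqP => [[/suffixP[t' ->]]|->].
  by rewrite size_cat addnK take_size_cat // => /eqP->.
by rewrite size_cat addnK take_size_cat // suffix_suffix.
Qed.

Lemma weight_start p u : (p < 6)%N ->
  fd_weight T [:: fd_start T] p u = if (p < 3)%N && (u == [::]) then c else 0.
Proof.
move=> lp; rewrite /= !big_cons big_nil !out_start !entry_start S_row /= subn0 take_size.
rewrite suffix0s /=; case: (u == [::]); rewrite ?andbF !mul0r !addr0 ?mul1r ?mul0r // andbT.
by do 6![case: p lp => [|p] lp //=].
Qed.

Lemma halting_ge3 p : (p < 6)%N -> fd_halting T p = (3 <= p)%N.
Proof. by do 6![case: p => [|p] //]. Qed.

(** Letters act by the identity matrix, so each of the states 0, 1, 2 keeps the weight [c] and
    collects its own outputs. *)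
Lemma weight_letters r p u : all (ltn^~ (size ts)) r -> (p < 6)%N ->
  fd_weight T (r ++ [:: fd_start T]) p u =
  if (p < 3)%N && (u == outputs (rev r) p) then c else 0.
Proof.
elim: r p u => [|a r IH] p u; first by move=> _ lp; rewrite weight_start.
move=> /andP[la lr] lp; rewrite cat_cons weight_cons; last by case: (r).
rewrite (sum_iota_single lp) => [|q lq nqp]; last first.
  by case: ifP => // _; rewrite entry_letter // eq_sym (negbTE nqp) mulr0.
rewrite entry_letter // eqxx mulr1 IH // halting_ge3 // out_letter //.
rewrite rev_cons /outputs map_rcons -cats1 flatten_cat /= cats0 -suffix_take -ltnNge.
by case: (suffix _ _); case: (p < 3)%N.
Qed.

Lemma weight_end r q u : all (ltn^~ (size ts)) r -> (q < 3)%N ->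
  fd_weight T (fd_end T :: r ++ [:: fd_start T]) (q + 3)%N u =
  if u == outputs (rev r) q ++ nth [::] (tile_row (e, [::])) q then c else 0.
Proof.
move=> lr lq; have q6 : (q < 6)%N := leq_trans lq (isT : (3 <= 6)%N).
rewrite weight_cons; last by case: (r).
rewrite (sum_iota_single q6) => [|i li niq]; last first.
  rewrite halting_ge3 //; case: ifP => // /andP[_]; rewrite -ltnNge => li3.
  rewrite entry_end E_row // (nth_map 0) ?size_iota ?nth_iota; try lia.
  by rewrite add0n eqn_add2r eq_sym (negbTE niq) mulr0.
rewrite weight_letters // lq out_end entry_end E_row //.
rewrite (nth_map 0) ?size_iota ?nth_iota; try lia.
rewrite add0n eqxx mulr1 halting_ge3 // leqNgt lq andbT -suffix_take.
by case: (suffix _ _).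
Qed.

(** [G] is the identity for probabilities and the squared modulus for amplitudes, so one computation
    serves both machines. *)
Lemma prob_sum (L : nmodType) (G : K -> L) v w : G 0 = 0 -> all (ltn^~ (size ts)) v ->
  \sum_(k < size (fd_tape T v)) \sum_(p <- iota 0 (fd_nst T) | p \in fd_acc T)
     G (fd_weight T (rev (take k.+1 (fd_tape T v))) p w) =
  G (if w == outputs v 0 ++ e then c else 0) + G (if w == outputs v 1 then c else 0).
Proof.
move=> G0 lv; have -> : size (fd_tape T v) = (size v).+2 by rewrite /= size_cat addn1.
have accE g : \sum_(p <- iota 0 (fd_nst T) | p \in fd_acc T) g p = g 3 + g 4 :> L.
  by rewrite !big_cons big_nil /= addr0.
rewrite big_ord_recr big1 => [|k _].
  rewrite take_oversize; last by rewrite /= size_cat addn1.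
  rewrite accE rev_cons rev_cat -cats1 (weight_end (q := 0)) ?all_rev //.
  by rewrite (weight_end (q := 1)) ?all_rev // revK cats0; apply: add0r.
(* Before the end marker is read, the accepting states 3 and 4 have weight zero. *)
rewrite /fd_tape take_cons take_cat; have lr n : all (ltn^~ (size ts)) (rev (take n v)).
  by rewrite all_rev; apply/allP => i /mem_take/(allP lv).
have -> : (if (k < size v)%N then take k v else v ++ take (k - size v) [:: fd_end T]) = take k v.
  case: ltnP => // le; have -> : (k : nat) = size v by have := ltn_ord k; lia.
  by rewrite subnn take_size cats0.
by rewrite accE rev_cons -cats1 !weight_letters //= G0 addr0.
Qed.

Lemma tile_shape_ok : (forall t, t \in (e, [::]) :: ts -> all (ltn^~ N) (t.1 ++ t.2)) ->
  size S = 6 -> all (fun r => size r == 6) S ->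
  size E = 6 -> all (fun r => size r == 6) E -> fd_shape_ok T.
Proof.
move=> tsN S6 S6' E6 E6'; split=> //.
- by move=> q; rewrite /= !inE; apply/negP => /andP[/orP[/eqP->|/eqP->]].
- split; first by rewrite /= size_cat size_nseq addn2.
  by rewrite /= all_cat all_nseq /= S6 S6' E6 E6' orbT.
split; first by rewrite /= size_cat size_map addn2.
have row t : t \in (e, [::]) :: ts -> all (all (fun b => b < N)%N) (tile_row t).
  by move=> /tsN; rewrite all_cat /= => /andP[-> ->].
apply/allP => F; rewrite mem_cat !inE => /or3P[/mapP[t tt ->]|/eqP->|/eqP->] //.
  by apply/andP; split=> //; apply: row; rewrite inE tt orbT.
by apply/andP; split=> //; apply/row/mem_head.
Qed.
End TileTransducer.

(** * The diagonal argument *)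

Definition tile_rel ts e v w := w = outputs ts v 0 ++ e /\ w = outputs ts v 1.

Definition enc_tile (t : seq sym * seq sym) := (map enc t.1, map enc t.2).

Lemma outputs_enc ts v : all (ltn^~ (size ts)) v ->
  outputs (map enc_tile ts) v 0 = map enc (tops [seq nth ([::], [::]) ts a | a <- v]) /\
  outputs (map enc_tile ts) v 1 = map enc (bots [seq nth ([::], [::]) ts a | a <- v]).
Proof.
elim: v => //= a v IH /andP[la /IH[E1 E2]].
have outputs_cons q : outputs (map enc_tile ts) (a :: v) q =
    nth [::] (tile_row (enc_tile (nth ([::], [::]) ts a))) q ++ outputs (map enc_tile ts) v q.
  by rewrite {1}/outputs /= (nth_map ([::], [::])).
by rewrite !outputs_cons E1 E2 -!map_cat.
Qed.

Lemma bounded_outputs N ts v q : (forall t, t \in ts -> all (ltn^~ N) (t.1 ++ t.2)) ->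
  all (ltn^~ (size ts)) v -> all (ltn^~ N) (outputs ts v q).
Proof.
move=> tsN /allP lv; apply/allP => b /flatten_mapP[a /lv la].
have := tsN _ (mem_nth ([::], [::]) la); rewrite all_cat => /andP[/allP h1 /allP h2].
case: q => [|[|q]]; [exact: h1 | exact: h2 |].
by do 4![case: q => [|q] //=]; rewrite nth_nil.
Qed.

Section Reduction.
Variables (K : nzRingType) (S E : seq (seq K)).

Lemma tile_rel_empty N ts e :
  (forall t, t \in map enc_tile ts -> all (ltn^~ N) (t.1 ++ t.2)) ->
  rel_empty (tile_fst S E N (map enc_tile ts) (map enc e))
    (tile_rel (map enc_tile ts) (map enc e)) <-> ~ solvable ts e.
Proof.
move=> tsN; split=> [empty [K' sK' E']|nsol v w lv _ [->]].
  pose v := map (index^~ ts) K'.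
  have lv : all (ltn^~ (size ts)) v.
    by apply/allP => a /mapP[t /sK' tt ->] /=; rewrite index_mem.
  have Ev : [seq nth ([::], [::]) ts a | a <- v] = K'.
    by rewrite -map_comp map_id_in // => t /sK' tt /=; rewrite nth_index.
  have [E0 E1] := outputs_enc lv; rewrite Ev in E0 E1.
  have lv' : all (ltn^~ (size (map enc_tile ts))) v by rewrite size_map.
  apply: (empty v (outputs (map enc_tile ts) v 1) lv'); first exact: bounded_outputs.
  by split=> //; rewrite E0 E1 -map_cat E'.
rewrite /= size_map in lv; have [-> ->] := outputs_enc lv; rewrite -map_cat.
move=> /(inj_map enc_inj) E'; apply: nsol; exists [seq nth ([::], [::]) ts a | a <- v] => //.
by move=> t /mapP[a av ->]; apply/mem_nth/(allP lv).
Qed.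

Lemma instr_bounds Q k0 M0 : exists k M,
  [/\ k0 <= k, M0 <= M & all (instr_ok k M) Q].
Proof.
elim: Q k0 M0 => [|i Q IH] k0 M0; first by exists k0, M0.
pose r := match i with CInc r | CDec r _ => r end.
pose q := match i with CInc _ => 0 | CDec _ q => q end.
have [k [M [lek leM ok]]] := IH (maxn k0 r.+1) (maxn M0 q.+1).
exists k, M; rewrite /= ok; move: lek leM; rewrite !geq_max => /andP[-> rk] /andP[-> qM].
by split=> //; rewrite andbT; case: (i) @r @q rk qM => /= [r -> //|r q -> ->].
Qed.

Lemma seq_bound s : exists N, all (ltn^~ N) s.
Proof.
exists (sumn s).+1; elim: s => //= a s IH; rewrite ltnS leq_addr /=.
by apply: sub_all IH => b; rewrite !ltnS => /leq_trans; apply; apply: leq_addl.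
Qed.

Variables (code : fst_desc K -> nat) (P : seq cm_instr).
Hypothesis codeE : forall nst nin nout q0 acc rej V, exists x, forall f,
  code (FstDesc nst nin nout q0 acc rej V f) = push x (push (pickle f) 0).

Definition end_word := [:: Bot; Start; Top].

Hypothesis P_decides : forall N ts,
  let T := tile_fst S E N (map enc_tile ts) (map enc end_word) in
  (forall t, t \in (map enc end_word, [::]) :: map enc_tile ts -> all (ltn^~ N) (t.1 ++ t.2)) ->
  (~ solvable ts end_word -> cm_halts_with P (code T) 1) /\
  (solvable ts end_word -> cm_halts_with P (code T) 0).

(* [Q] started on [(x, y)] runs [P] on the code of the transducer whose first tile
   launches [Q] on [(x, y)], provided [x] and [y] are the two parts of this code
   that do not depend on [(x, y)]. *)
Lemma tile_emptiness_undecidable : False.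
Proof.
(* In the row of the launching tile, [z] codes the entries after the first, which do not depend on
   [(x, y)]. *)
pose z := pickle [:: [:: enc Start]; [::]; [::]; [::]; [::]].
pose c := build (enc (Reg 2)) (enc (Reg 3)) (enc (Head 0)) z.
pose Q := diag_prog c 8 P.
(* The bound 4 admits the letters [Reg 2] and [Reg 3] of the initial word. *)
have [k [M [k4 ltQM Qok]]] := instr_bounds Q 4 (size Q).+1.
pose base := map enc_tile (base_tiles Q k M).
(* [N] enters [x], so it must be fixed before the initial word; listing that word's possible letters
   suffices. *)
have [N] := seq_bound (map enc [:: Start; Bot; Top; Head 0; Reg 2; Reg 3] ++
  flatten [seq t.1 ++ t.2 | t <- base]).
rewrite all_cat => /andP[N1 /allP N2].
have [x codex] := codeE 6 (size base).+1 N 0 [:: 3; 4] [:: 5]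
  (nseq (size base).+1 (map (unit_row K) (iota 0 6)) ++ [:: S; E]).
(* All output rows but that of the launching tile; neither [x] nor [y] mentions [init], so the
   construction is not circular. *)
pose y := pickle (map tile_row base ++ [:: nseq 6 [::]; tile_row (map enc end_word, [::])]).
pose init := nseq x 2 ++ nseq y 3.
pose ts := tiles Q k M init.
have tsN t : t \in (map enc end_word, [::]) :: map enc_tile ts -> all (ltn^~ N) (t.1 ++ t.2).
  move: N1 => /= /and5P[n0 n1 n2 n3 /and3P[n4 n5 _]].
  rewrite 2!inE => /or3P[/eqP->|/eqP->|tb]; first by rewrite /= n0 n1 n2.
    rewrite all_cat /= n0 n3 /= andbT /init !map_cat !map_nseq all_cat !all_nseq.
    by rewrite /= n4 n5 !orbT.
  by apply/allP => b bt; apply: N2; apply/flattenP; exists (t.1 ++ t.2) => //;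
    exact: (map_f (fun t => t.1 ++ t.2) tb).
have [H1 H0] := P_decides tsN.
set T := tile_fst _ _ _ _ _ in H1 H0.
have codeT : code T = push x (push (push (push (push (enc (Head 0))
    (iter x (push (enc (Reg 2))) (iter y (push (enc (Reg 3))) 0))) z) y) 0).
  rewrite codex; congr (push x (push _ 0)).
  rewrite [map tile_row _]/= cat_cons pickle_cons -/base -/y; congr (push _ y).
  rewrite /tile_row pickle_cons /z; congr push.
  rewrite -[(enc_tile _).1]/(enc (Head 0) :: map enc (map Reg init)) pickle_cons.
  congr push; rewrite /init !map_cat !map_nseq pickle_nseq_cat.
  by rewrite -[nseq y _]cats0 pickle_nseq_cat.
have [s evs Es] := ev_build (enc (Reg 2)) (enc (Reg 3)) (enc (Head 0)) z x y.
rewrite -codeT in Es.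
have reg_init : regs2 x y = fun j => count_mem j init.
  apply: functional_extensionality => j; rewrite /regs2 /upd count_cat !count_nseq /=.
  by case: j => [|[|[|[|j]]]]; rewrite /= ?mul0n ?mul1n ?addn0.
have init_ok : all (ltn^~ k) init.
  by rewrite all_cat !all_nseq /= (leq_trans _ k4) ?(leq_trans _ k4) ?orbT.
have solP := solvableP Qok ltQM init_ok.
rewrite -reg_init in solP.
(* Solvability means that [Q] halts on its own parameters, that is, that [P] answers nonzero on [T];
   yet [P] answers 0 exactly in the solvable case. *)
have diag i : cm_halts_with P (code T) i -> solvable ts end_word <-> i <> 0.
  by move=> /(diag_progP evs erefl Es); rewrite -/Q => hP; rewrite solP.
have nsol : ~ solvable ts end_word by move=> sol; have /diag[/(_ sol)] := H0 sol.
by apply: (nsol); have /diag[_] := H1 nsol; apply.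
Qed.
End Reduction.

(** * Probabilistic and quantum matrices *)

Local Open Scope ring_scope.

Lemma letter_cases n a : (a < n.+2)%N -> [\/ (a < n)%N, a = n | a = n.+1].
Proof.
rewrite !ltnS leq_eqVlt => /orP[/eqP->|]; first by constructor 3.
by rewrite ltnS leq_eqVlt => /orP[/eqP->|]; [constructor 2 | constructor 1].
Qed.

Lemma sum_iota6 (V : nmodType) (F : nat -> V) :
  \sum_(q <- iota 0 6) F q = F 0 + (F 1 + (F 2 + (F 3 + (F 4 + F 5)))).
Proof. by rewrite !big_cons big_nil addr0. Qed.

Lemma nth_unit_row (K : nzRingType) j q : (q < 6)%N -> nth 0 (unit_row K j) q = (q == j)%:R.
Proof. by move=> lq; rewrite (nth_map 0) ?size_iota // nth_iota. Qed.

(** * The probabilistic machine *)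

Definition prob_start : seq (seq rat) := nseq 6 [:: 3^-1; 3^-1; 3^-1; 0; 0; 0].
(** Every state, halting or not, must be sent to a halting one; reduction modulo 3 achieves this. *)
Definition prob_end : seq (seq rat) := [seq unit_row rat (i %% 3 + 3)%N | i <- iota 0 6].

Lemma nth_prob_end i : (i < 6)%N -> nth [::] prob_end i = unit_row rat (i %% 3 + 3)%N.
Proof. by move=> li; rewrite (nth_map 0) ?size_iota // nth_iota. Qed.

Section Probabilistic.
Variables (N : nat) (ts : seq (seq nat * seq nat)) (e : seq nat).
Hypothesis tsN : forall t, t \in (e, [::]) :: ts -> all (ltn^~ N) (t.1 ++ t.2).
Local Notation T := (tile_fst prob_start prob_end N ts e).

Lemma prob_entry a q : (a < (fd_nin T).+2)%N -> (q < 6)%N ->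
  (exists2 j, (j < 6)%N & forall p, (p < 6)%N -> fd_entry T a q p = (p == j)%:R) \/
  (forall p, fd_entry T a q p = nth 0 [:: 3^-1; 3^-1; 3^-1; 0; 0; 0] p).
Proof.
move=> /letter_cases[la|->|->] lq.
- by left; exists q => // p lp; rewrite entry_letter.
- by right=> p; rewrite -/(fd_start T) entry_start nth_nseq lq.
left; exists (q %% 3 + 3)%N => [|p lp]; first by lia.
by rewrite -/(fd_end T) entry_end nth_prob_end // nth_unit_row.
Qed.

Lemma prob_wf : pfst_wf T.
Proof.
split; first exact: tile_shape_ok.
split=> [a q la lq|q p lq lp]; last first.
  rewrite entry_end nth_prob_end // nth_unit_row // halting_ge3 // -ltnNge => lp3.
  by case: eqP => // Ep; move: lp3; rewrite Ep ltnNge leq_addl.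
have [[j lj Ej]|Ej] := prob_entry la lq.
  split=> [p lp|]; first by rewrite Ej ?ler0n.
  rewrite (sum_iota_single lj) ?Ej ?eqxx // => p lp npj.
  by rewrite Ej // (negbTE npj).
split=> [p lp|]; first by rewrite Ej; do 6![case: p lp => [|p] lp //=].
by rewrite sum_iota6 !Ej /=; field.
Qed.

Lemma prob_computes : pfst_computes T (tile_rel ts e) (2%:R / 3%:R).
Proof.
have E_row i : (i < 3)%N -> nth [::] prob_end i = unit_row rat (i + 3)%N by case: i => [|[|[|]]].
move=> v w lv _; have -> : pfst_prob T v w =
    (if w == outputs ts v 0 ++ e then 3^-1 else 0) + (if w == outputs ts v 1 then 3^-1 else 0).
  exact: (@prob_sum _ 3^-1 prob_start _ N ts e erefl E_row _ id v w erefl lv).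
split=> [[-> ->]|nr]; first by rewrite !eqxx; lra.
case: eqP => [E0|_]; case: eqP => [E1|_]; try lra.
by case: nr; split.
Qed.
End Probabilistic.

(** * The quantum machine *)

Definition amp n : algC := sqrtC n%:R^-1.

Lemma amp_sqr n : amp n * amp n = n%:R^-1.
Proof. by rewrite -expr2 sqrtCK. Qed.

Lemma amp_conj n : (amp n)^* = amp n.
Proof. by apply: geC0_conj; rewrite sqrtC_ge0 invr_ge0 ler0n. Qed.

(** The normalised orthogonal vectors (1,1,1), (1,-1,0), (1,1,-2), completed by the identity on the
    halting states. *)
Definition quant_start : seq (seq algC) :=
  [:: [:: amp 3; amp 3; amp 3; 0; 0; 0]; [:: amp 2; - amp 2; 0; 0; 0; 0];
      [:: amp 6; amp 6; - (2 * amp 6); 0; 0; 0];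
      unit_row algC 3; unit_row algC 4; unit_row algC 5].
(** A permutation exchanging the non-halting states with the halting ones. *)
Definition quant_end : seq (seq algC) := [seq unit_row algC ((i + 3) %% 6)%N | i <- iota 0 6].

Lemma nth_quant_end i : (i < 6)%N -> nth [::] quant_end i = unit_row algC ((i + 3) %% 6)%N.
Proof. by move=> li; rewrite (nth_map 0) ?size_iota // nth_iota. Qed.

Lemma unitary_entries n (M : 'M[algC]_n) :
  (forall i j, \sum_k M i k * (M j k)^* = (i == j)%:R) -> M \is unitarymx.
Proof.
by move=> H; apply/unitarymxP/matrixP => i j; rewrite !mxE -H; apply: eq_bigr => k _; rewrite !mxE.
Qed.

Lemma unitary_unit n (M : 'M[algC]_n) (s : nat -> nat) : (forall i, i < n -> s i < n)%N ->
  {in gtn n &, injective s} -> (forall i j, M i j = (j == s i :> nat)%:R) -> M \is unitarymx.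
Proof.
move=> sn s_inj EM; apply: unitary_entries => i j.
rewrite (bigD1 (Ordinal (sn i (ltn_ord i)))) //= big1 => [|k nk]; last first.
  rewrite EM; case: eqP => [Ek|]; last by rewrite mul0r.
  by case/eqP: nk; apply: val_inj.
rewrite !EM eqxx addr0 mul1r conjC_nat; congr (nat_of_bool _)%:R.
apply/eqP/eqP => [E|-> //]; apply: val_inj; apply: s_inj => //; exact: ltn_ord.
Qed.

(** The inner products of the rows of [quant_start], with the square roots abstracted to elements of
    known square. *)
Lemma start_rows (F : numFieldType) (a b d : F) :
  a * a = 3^-1 -> b * b = 2^-1 -> d * d = 6^-1 ->
  [/\ a * a + (a * a + a * a) = 1, b * b + b * b = 1,
      d * d + (d * d + 2 * d * (2 * d)) = 1,
      a * d + (a * d - a * (2 * d)) = 0 & d * a + (d * a - 2 * d * a) = 0].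
Proof.
by move=> Ea Eb Ed; rewrite (mulrACA 2) Ea Eb Ed; split; [field|field|field|ring|ring].
Qed.

Lemma third_compl (F : numFieldType) : 1 - 2 / 3 = 3^-1 :> F.
Proof. by field. Qed.

Section Quantum.
Variables (N : nat) (ts : seq (seq nat * seq nat)) (e : seq nat).
Hypothesis tsN : forall t, t \in (e, [::]) :: ts -> all (ltn^~ N) (t.1 ++ t.2).
Local Notation T := (tile_fst quant_start quant_end N ts e).

Lemma quant_start_unitary : fd_mx T (fd_start T) \is unitarymx.
Proof.
have [n3 n2 n6 ad da] := start_rows (amp_sqr 3) (amp_sqr 2) (amp_sqr 6).
apply: unitary_entries => i j.
under eq_bigr do rewrite !mxE !entry_start.
rewrite -(big_mkord xpredT (fun k => nth 0 (nth [::] quant_start i) k *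
  (nth 0 (nth [::] quant_start j) k)^*)) /index_iota sum_iota6 -val_eqE.
case: i j => [i li] [j lj] /=.
case: i li => [|[|[|[|[|[|i]]]]]] // _; case: j lj => [|[|[|[|[|[|j]]]]]] // _;
  rewrite /= ?rmorphN ?rmorphM /= ?amp_conj ?conjC0 ?conjC1 ?conjC_nat
    ?mul0r ?mulr0 ?addr0 ?add0r ?mulr1 //;
  by rewrite ?mulNr ?mulrN ?opprK ?subrr.
Qed.

Lemma quant_wf : qfst_wf T.
Proof.
split; first exact: tile_shape_ok.
split=> [a /letter_cases[la|->|->]|q p lq lp].
- apply: (@unitary_unit _ _ id) => // i j.
  by rewrite mxE entry_letter // ltn_ord.
- exact: quant_start_unitary.
- apply: (@unitary_unit _ _ (fun i => (i + 3) %% 6)%N) => [i _|i j|i j].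
  + exact: ltn_pmod.
  + move=> li lj /=; have {}li : (i < 6)%N := li; have {}lj : (j < 6)%N := lj; lia.
  by rewrite mxE -/(fd_end T) entry_end nth_quant_end ?ltn_ord // nth_unit_row ?ltn_ord.
rewrite !halting_ge3 // -!ltnNge => lq3 lp3.
rewrite entry_end nth_quant_end // nth_unit_row //.
by case: eqP => // Ep; move: lp3; rewrite Ep modn_small ltnNge ?leq_addl //; lia.
Qed.

Lemma quant_computes : qfst_computes T (tile_rel ts e) (2%:R / 3%:R).
Proof.
have E_row i : (i < 3)%N -> nth [::] quant_end i = unit_row algC (i + 3)%N by case: i => [|[|[|]]].
pose G (x : algC) := `|x| ^+ 2; have G0 : G 0 = 0 by rewrite /G normr0 expr0n.
have G3 : G (amp 3) = 3^-1.
  by rewrite /G ger0_norm ?sqrtC_ge0 ?invr_ge0 ?ler0n // sqrtCK.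
move=> v w lv _; have -> : qfst_prob T v w =
    (if w == outputs ts v 0 ++ e then 3^-1 else 0) + (if w == outputs ts v 1 then 3^-1 else 0).
  have := @prob_sum _ (amp 3) quant_start _ N ts e erefl E_row _ G v w G0 lv.
  by rewrite !(fun_if G) G0 G3.
have third : 0 <= 3^-1 :> algC by rewrite invr_ge0 ler0n.
split=> [[-> ->]|nr].
  by rewrite !eqxx mulr_natl mulr2n.
rewrite third_compl; case: eqP => [E0|_]; case: eqP => [E1|_]; rewrite ?addr0 ?add0r //.
by case: nr; split.
Qed.
End Quantum.

(** The output table is the last component of the coded tuple, so everything else, including the
    matrices, is absorbed into [x]. *)
Lemma fd_code_split (K : countType) nst nin nout q0 acc rej (V : seq (seq (seq K))) :
  exists x, forall f,
    fd_code (FstDesc nst nin nout q0 acc rej V f) = push x (push (pickle f) 0).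
Proof.
exists (pickle (nst, nin, nout, q0, acc, rej, V)) => f.
by rewrite /fd_code /= pickle_pair.
Qed.

Theorem theorem2 :
  (~ exists P : seq cm_instr, decides_pfst_emptiness P) /\
  (~ exists P : seq cm_instr, decides_qfst_emptiness P).
Proof.
split=> -[P dec].
  apply: (@tile_emptiness_undecidable rat prob_start prob_end (@fd_code rat) P).
    exact: fd_code_split.
  move=> N ts T tsN; have [H1 H0] := dec T _ (prob_wf tsN) (prob_computes (e := _)).
  have tsN' t : t \in map enc_tile ts -> all (ltn^~ N) (t.1 ++ t.2).
    by move=> tt; apply: tsN; rewrite inE tt orbT.
  have empty := tile_rel_empty prob_start prob_end end_word tsN'.
  split=> sol; first by apply: H1; apply/empty.
  by apply: H0 => /empty.
apply: (@tile_emptiness_undecidable algC quant_start quant_end (@fd_code algC) P).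
  exact: fd_code_split.
move=> N ts T tsN; have [H1 H0] := dec T _ (quant_wf tsN) (quant_computes (e := _)).
have tsN' t : t \in map enc_tile ts -> all (ltn^~ N) (t.1 ++ t.2).
  by move=> tt; apply: tsN; rewrite inE tt orbT.
have empty := tile_rel_empty quant_start quant_end end_word tsN'.
split=> sol; first by apply: H1; apply/empty.
by apply: H0 => /empty.
Qed.
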